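(* Let $F=\langle\Sigma,\Delta,Q,\tilde q,f\rangle$ be a finite automaton with $|Q|=n$, let $\omega\in\Sigma^{\mathbb{N}}$ be strongly almost periodic, and let $r_\omega$ be an almost periodicity regulator of $\omega$. Then $F(\omega)$ is eventually strongly almost periodic and $$\mathrm{pr}(F(\omega))\le r_\omega^n(1)+r_\omega^{n-1}(1)+\dots+r_\omega(1),$$ where $r_\omega^k$ denotes the $k$-fold composition $r_\omega\circ\dots\circ r_\omega$.
   Context: A finite automaton is a tuple $F=\langle\Sigma,\Delta,Q,\tilde q,f\rangle$ with finite input alphabet $\Sigma$, finite output alphabet $\Delta$, finite state set $Q$, initial state $\tilde q$ and transition function $f\colon Q\times\Sigma\to Q\times\Delta$; for $\alpha\in\Sigma^{\mathbb{N}}$ set $p_0=\tilde q$, $\langle p_{k+1},\beta(k)\rangle=f(p_k,\alpha(k))$, and $F(\alpha)=\beta$. For a sequence $\omega$, write $\omega[i,j]=\omega(i)\dots\omega(j)$ and $\omega[i,\infty)$ for the suffix starting at position $i$; a factor is a nonempty string $\omega[i,j]$. A sequence is strongly almost periodic (SAP) if for every factor $x$ there is $l$ such that every factor of length $l$ contains an occurrence of $x$; it is eventually strongly almost periodic if some suffix is SAP, and then $\mathrm{pr}(\omega)$ denotes the least $m$ such that $\omega[m,\infty)$ is SAP. A function $r\colon\mathbb{N}\to\mathbb{N}$ is an almost periodicity regulator of $\omega$ if (1) every string of length $k$ occurring in $\omega$ infinitely many times occurs in every factor of $\omega$ of length $r(k)$, and (2) every string of length $k$ occurring in $\omega$ only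 finitely many times does not occur in $\omega[r(k),\infty)$. *)

(* Defs.v *)
From mathcomp Require Import all_boot.

Set Implicit Arguments.
Unset Strict Implicit.
Unset Printing Implicit Defensive.

Section Sequences.
Variable T : eqType.
Implicit Types (w : nat -> T) (x : seq T) (r : nat -> nat).

(* The string w(i) ... w(i + l - 1), i.e. w[i, i + l - 1]; empty for l = 0. *)
Definition window w (i l : nat) : seq T := mkseq (fun t => w (i + t)) l.

Definition suffix_from w (m : nat) : nat -> T := fun t => w (m + t).

Definition occurs_at w x (i : nat) : Prop := window w i (size x) = x.

Definition occurs w x : Prop := exists i, occurs_at w x i.

Definition factor w x : Prop := x != [::] /\ occurs w x.

Definition occurs_infinitely w x : Prop :=
  forall N, exists2 i, N <= i & occurs_at w x i.

(* "Every factor of length l contains x" is read as a quantification over all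
   positions i of windows of length l. For l = 0 the windows are empty and
   contain no nonempty x, so that l = 0 does not satisfy the condition
   vacuously. *)
Definition every_window_contains w (l : nat) x : Prop :=
  forall i, infix x (window w i l).

Definition SAP w : Prop :=
  forall x, factor w x -> exists l, every_window_contains w l x.

Definition eventually_SAP w : Prop := exists m, SAP (suffix_from w m).

(* pr(w) = m, as a relation: m is the least index of an SAP suffix of w. *)
Definition is_pr w (m : nat) : Prop :=
  SAP (suffix_from w m) /\ forall m', SAP (suffix_from w m') -> m <= m'.

Definition ap_regulator w r : Prop :=
  (forall x, occurs_infinitely w x -> every_window_contains w (r (size x)) x) /\
  (forall x, ~ occurs_infinitely w x ->
     ~ occurs (suffix_from w (r (size x))) x).

End Sequences.

Record automaton (Sigma Delta Q : finType) := Automaton {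
  init : Q;
  trans : Q * Sigma -> Q * Delta }.

Section Run.
Variables (Sigma Delta Q : finType) (F : automaton Sigma Delta Q).

Fixpoint state (a : nat -> Sigma) (k : nat) : Q :=
  if k is k'.+1 then (trans F (state a k', a k')).1 else init F.

Definition run (a : nat -> Sigma) : nat -> Delta :=
  fun k => (trans F (state a k, a k)).2.

End Run.

(* Main.v *)
(** Let the rank of a word be the number of states it can lead to when the
    initial state is arbitrary. After an occurrence of a factor [u] of minimal
    rank, the words leading from one occurrence of [u] to a later one permute
    the set of states reachable through [u]; this reversibility makes the rest
    of the output strongly almost periodic. To reach the minimal rank early,
    start from a letter and pass repeatedly to a word joining two consecutive
    occurrences of the current word on which the rank drops: up to a bounded
    number of forced letters at its end, its length is given by iterating the
    regulator. *)
Require Import Defs.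
From mathcomp Require Import all_boot.
From mathcomp Require Import zify.
From Stdlib Require Import Classical.

Set Implicit Arguments.
Unset Strict Implicit.
Unset Printing Implicit Defensive.

Lemma ex_least (P : nat -> Prop) (m : nat) :
  P m -> exists2 k, P k & forall k', P k' -> k <= k'.
Proof.
elim/ltn_ind: m => m IHm Pm.
case: (classic (exists2 k, k < m & P k)) => [[k lt_km Pk]|noP].
  exact: IHm lt_km Pk.
exists m => // k' Pk'; rewrite leqNgt; apply/negP => lt_k'm.
by apply: noP; exists k'.
Qed.

(** * Occurrences of words in a sequence, and the regulator of an SAP sequence *)

Section Windows.
Variable T : eqType.
Implicit Types (w : nat -> T) (x y : seq T).

Lemma size_window w i l : size (window w i l) = l.
Proof. exact: size_mkseq. Qed.

Lemma window_cat w i l1 l2 :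
  window w i (l1 + l2) = window w i l1 ++ window w (i + l1) l2.
Proof.
rewrite /window /mkseq iotaD map_cat add0n; congr (_ ++ _).
by rewrite -{1}[l1]addn0 iotaDl -map_comp; apply: eq_map => t /=; rewrite addnA.
Qed.

Lemma occurs_at_window w i l : occurs_at w (window w i l) i.
Proof. by rewrite /occurs_at size_window. Qed.

Lemma occurs_at_cat w x y i :
  occurs_at w (x ++ y) i <-> occurs_at w x i /\ occurs_at w y (i + size x).
Proof.
rewrite /occurs_at size_cat window_cat; split=> [/eqP|[-> ->]] //.
by rewrite eqseq_cat ?size_window // => /andP[/eqP ? /eqP ?].
Qed.

Lemma infix_windowP w x i l :
  reflect (exists2 d, d + size x <= l & occurs_at w x (i + d))
          (infix x (window w i l)).
Proof.
apply: (iffP (@infixP _ _ _)) => [[s1 [s2 def_win]]|[d le_dl occ_x]].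
  exists (size s1).
    by move/(congr1 size): def_win; rewrite size_window !size_cat; lia.
  have := occurs_at_window w i l; rewrite def_win.
  by case/occurs_at_cat=> _ /occurs_at_cat[].
exists (window w i d), (window w (i + (d + size x)) (l - (d + size x))).
rewrite -{1}(subnKC le_dl) !window_cat -catA; congr (_ ++ (_ ++ _)).
exact: occ_x.
Qed.

Lemma sub_occurs_at w x i j l d :
  occurs_at w (window w i l) j -> d + size x <= l ->
  occurs_at w x (i + d) <-> occurs_at w x (j + d).
Proof.
rewrite /occurs_at size_window => eq_win le_dl.
suff ->: window w (i + d) (size x) = window w (j + d) (size x) by [].
apply: (@eq_from_nth _ (w 0)); rewrite !size_window // => t lt_t.
have := congr1 (fun s => nth (w 0) s (d + t)) eq_win.
rewrite /window !nth_mkseq //; try lia.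
by rewrite !addnA.
Qed.

(** A nonempty word that occurs once recurs arbitrarily far by SAP, so the first regulator clause
    applies to it. *)
Lemma SAP_regulator w r x : SAP w -> ap_regulator w r -> occurs w x ->
  every_window_contains w (r (size x)) x.
Proof.
move=> sap_w [reg_w _] occ_x; apply: reg_w => N.
have [->|x_neq0] := eqVneq x [::]; first by exists N.
have [l /(_ N)/infix_windowP[d _ occ_d]] := sap_w x (conj x_neq0 occ_x).
by exists (N + d); first exact: leq_addr.
Qed.

(** Some word of length [l] occurs, and it has to fit into a window of length [r l]. *)
Lemma regulator_ge w r l : SAP w -> ap_regulator w r -> l <= r l.
Proof.
move=> sap_w reg_w.
have occ : occurs w (window w 0 l) by exists 0; exact: occurs_at_window.
have /infix_windowP[d] := SAP_regulator sap_w reg_w occ 0.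
by rewrite size_window => /(leq_trans (leq_addl _ _)).
Qed.

End Windows.

(** * Runs of the automaton on words, and the rank of a word *)

Section Automaton.
Variables (Sigma Delta Q : finType) (F : automaton Sigma Delta Q).
Implicit Types (w : nat -> Sigma) (x y u z : seq Sigma) (q : Q).

Definition goto q x : Q := foldl (fun p a => (trans F (p, a)).1) q x.

Fixpoint out q x : seq Delta :=
  if x is a :: x' then (trans F (q, a)).2 :: out (trans F (q, a)).1 x'
  else [::].

(** Its cardinality is the rank of [x]. *)
Definition img x : {set Q} := [set goto q x | q : Q].

Lemma goto_cat q x y : goto q (x ++ y) = goto (goto q x) y.
Proof. exact: foldl_cat. Qed.

Lemma out_cat q x y : out q (x ++ y) = out q x ++ out (goto q x) y.
Proof. by elim: x q => //= a x IHx q; rewrite IHx. Qed.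

Lemma state_window w i l : goto (state F w i) (window w i l) = state F w (i + l).
Proof.
elim: l => [|l IHl]; first by rewrite addn0.
by rewrite -addn1 window_cat goto_cat IHl /= addn0 addnA addn1.
Qed.

Lemma out_window w i l : out (state F w i) (window w i l) = window (run F w) i l.
Proof.
elim: l => [|l IHl] //.
rewrite -addn1 !window_cat out_cat IHl state_window.
by rewrite /window /mkseq /= !addn0.
Qed.

Lemma img_cat x y : img (x ++ y) = [set goto q y | q in img x].
Proof.
rewrite /img -imset_comp; apply: eq_imset => q /=; exact: goto_cat.
Qed.

Lemma img_catr x y : img (x ++ y) \subset img y.
Proof.
by apply/subsetP => _ /imsetP[q _ ->]; rewrite goto_cat imset_f.
Qed.

Lemma rank_catl x y : #|img (x ++ y)| <= #|img x|.
Proof. by rewrite img_cat leq_imset_card. Qed.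

(** Letters put before [x] restrict the states from which it is read; letters put after it map its
    image by a function. *)
Lemma rank_infix x y : infix x y -> #|img y| <= #|img x|.
Proof.
case/infixP=> [s1 [s2 ->]]; rewrite catA; apply: leq_trans (rank_catl _ _) _.
exact/subset_leq_card/img_catr.
Qed.

Lemma rank_gt0 x : 0 < #|img x|.
Proof. by apply/card_gt0P; exists (goto (init F) x); exact: imset_f. Qed.

(* Among the words [z] such that [u ++ z] is a factor, we take one for which
   the most states of [img u] produce [x] while reading [z]. As the words
   between occurrences of [u] permute [img u], prepending one of them cannot
   enlarge that set of states, hence the set cannot miss any state from which
   [x] has once been produced. *)
Lemma SAP_after_min_rank w r u i : SAP w -> ap_regulator w r ->
    occurs_at w u i -> (forall y, occurs w y -> #|img u| <= #|img y|) ->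
  SAP (suffix_from (run F w) (i + size u)).
Proof.
move=> sap_w reg_w occ_u min_u x [_ [t0 occ_x]].
pose T z := [set q in img u | infix x (out q z)].
have [_ [z [b0 occ_z] ->] max_z] :
    exists2 k, (exists2 z, occurs w (u ++ z) & k = #|Q| - #|T z|)
      & forall k', (exists2 z, occurs w (u ++ z) & k' = #|Q| - #|T z|) ->
        k <= k'.
  apply: (@ex_least _ (#|Q| - #|T [::]|)).
  by exists [::] => //; rewrite cats0; exists i.
(* The given occurrence of [x] in the output ends at [e]; for [b] beyond it, the word [h] below is
   long enough to output [x]. *)
pose e := i + size u + t0 + size x.
have hit b : e <= b -> occurs_at w (u ++ z) b ->
    infix x (window (run F w) (b + size u) (size z)).
  move=> le_eb /occurs_at_cat[occ_ub occ_zb].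
  pose h := window w (i + size u) (b - i).
  have end_h : i + size u + (b - i) = b + size u by rewrite /e in le_eb; lia.
  have occ_uh : occurs_at w (u ++ h) i.
    by apply/occurs_at_cat; split=> //; exact: occurs_at_window.
  have occ_uhz : occurs_at w (u ++ h ++ z) i.
    apply/occurs_at_cat; split=> //; apply/occurs_at_cat; split.
      exact: occurs_at_window.
    by rewrite size_window end_h.
  (* As [u ++ h] ends with [u], its image lies in [img u]; minimality of the rank then makes [h]
     permute [img u]. *)
  have uhE : u ++ h = window w i (b - i) ++ u.
    rewrite -occ_uh size_cat size_window addnC window_cat; congr (_ ++ _).
    by rewrite subnKC //; rewrite /e in le_eb; lia.
  have sub_h : [set goto q h | q in img u] \subset img u.
    by rewrite -img_cat uhE img_catr.
  have inj_h : {in img u &, injective (goto^~ h)}.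
    apply/imset_injP; rewrite eqn_leq leq_imset_card /= -img_cat.
    by apply: min_u; exists i.
  have img_h : [set goto q h | q in img u] = img u.
    apply/eqP; rewrite eqEcard sub_h -img_cat.
    by apply: min_u; exists i.
  pose P := [set q in img u | goto q h \in T z].
  have sub_P : P \subset T (h ++ z).
    apply/subsetP => q; rewrite !inE => /andP[-> /andP[_ x_in]] /=.
    by rewrite out_cat; apply: infix_catl.
  have card_P : #|T z| <= #|P|.
    rewrite -(card_in_imset (f := goto^~ h) (D := P)); last first.
      by move=> q q' /setIdP[? _] /setIdP[? _]; exact: inj_h.
    apply/subset_leq_card/subsetP => q Tq.
    have: q \in [set goto q h | q in img u].
      by rewrite img_h; case/setIdP: Tq.
    by case/imsetP=> q' q'_u def_q; rewrite def_q imset_f // inE q'_u -def_q.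
  have eq_P : P = T (h ++ z).
    apply/eqP; rewrite eqEcard sub_P (leq_trans _ card_P) //.
    have := max_z _ (ex_intro2 _ _ (h ++ z) (ex_intro _ i occ_uhz) erefl).
    by have := max_card (T z); have := max_card (T (h ++ z)); lia.
  (* The actual run outputs [x] along [h]; by [eq_P] it must do so again along [z]. *)
  have stateT : state F w (i + size u) \in T (h ++ z).
    rewrite inE -state_window occ_u imset_f //=.
    rewrite -[X in goto _ X]occ_u state_window.
    have hz : h ++ z = window w (i + size u) (b - i + size z).
      by rewrite window_cat -/h end_h occ_zb.
    rewrite hz out_window; apply/infix_windowP.
    exists t0; first by rewrite /e in le_eb; lia.
    rewrite /occurs_at -[RHS]occ_x.
    by apply: eq_mkseq => s; rewrite /suffix_from addnA.
  move: stateT; rewrite -eq_P inE => /andP[_].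
  by rewrite state_window end_h inE -out_window occ_zb => /andP[].
(* Skipping [e] positions puts the next occurrence of [u ++ z] where [hit] applies. *)
exists (e + r (size (u ++ z))) => s.
have /infix_windowP[d le_d occ_d] :
  infix (u ++ z) (window w (i + size u + s + e) (r (size (u ++ z)))).
  by apply: SAP_regulator => //; exists b0.
have /infix_windowP[d' le_d' occ_d'] := hit _ (leq_trans (leq_addl _ _)
  (leq_addr _ _)) occ_d.
apply/infix_windowP; exists (e + d + size u + d').
  by move: le_d; rewrite size_cat; lia.
rewrite /occurs_at -[RHS]occ_d'; apply: eq_mkseq => t.
by rewrite /suffix_from; congr (run F w _); lia.
Qed.

(* If the rank dropped on no word joining consecutive occurrences of [V], it
   would remain constant along [w] after the first of them. *)
Lemma rank_drop w r u0 V U : SAP w -> ap_regulator w r ->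
    occurs w u0 -> occurs w V -> 0 < size V ->
    (forall j, occurs_at w V j -> occurs_at w U j) ->
  exists i d, [/\ occurs_at w V i, 0 < d, occurs_at w V (i + d),
    (forall d', 0 < d' -> occurs_at w V (i + d') -> d <= d') &
    #|img (window w i (d + size U))| <= maxn #|img u0| #|img U|.-1].
Proof.
move=> sap_w reg_w occ_u0 [i0 occ_i0] V_gt0 VU; apply: NNPP => no_drop.
have next i : occurs_at w V i -> exists d, [/\ 0 < d, occurs_at w V (i + d) &
    maxn #|img u0| #|img U|.-1 < #|img (window w i (d + size U))|].
  move=> occ_i.
  have /infix_windowP[d1 _ occ_d1] :=
    SAP_regulator sap_w reg_w (ex_intro _ i0 occ_i0) i.+1.
  have [d [d_gt0 occ_d] min_d] :
      exists2 d, 0 < d /\ occurs_at w V (i + d)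
        & forall d', 0 < d' /\ occurs_at w V (i + d') -> d <= d'.
    by apply: (@ex_least _ d1.+1); rewrite -addSnnS.
  exists d; split=> //; rewrite ltnNge; apply/negP => le_rank.
  by apply: no_drop; exists i, d; split=> // d' ? ?; apply: min_d.
have windowU i d : occurs_at w V (i + d) ->
    window w i (d + size U) = window w i d ++ U.
  by move=> /VU occ_U; rewrite window_cat occ_U.
have rankU : #|img u0| < #|img U|.
  have [d [_ occ_d]] := next _ occ_i0.
  rewrite gtn_max => /andP[lt_u0 _]; apply: leq_trans lt_u0 _.
  by rewrite windowU // subset_leq_card // img_catr.
have chain N : exists2 c, N <= c & occurs_at w V (i0 + c) /\
    #|img U| <= #|img (window w i0 (c + size U))|.
  elim: N => [|N [c le_Nc [occ_c rank_c]]].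
    by exists 0; rewrite ?addn0 ?add0n //; split=> //; rewrite (VU _ occ_i0).
  have [d [d_gt0 occ_d rank_d]] := next _ occ_c.
  exists (c + d); first by lia.
  split; first by rewrite addnA.
  (* The word ends with [U], so equal ranks give equal images, and only the next return to [V]
     matters. *)
  have img_c : img (window w i0 (c + size U)) = img U.
    by apply/eqP; rewrite eqEcard rank_c andbT windowU // img_catr.
  have -> : c + d + size U = c + size U + d by lia.
  rewrite window_cat img_cat img_c -img_cat.
  have {2}<- := VU _ occ_c; rewrite addnA -window_cat [size U + d]addnC.
  by move: rank_d; rewrite gtn_max => /andP[_]; lia.
(* A long enough window contains [u0], whose rank is smaller than that of [U]. *)
have /infix_windowP[d le_d occ_d] := SAP_regulator sap_w reg_w occ_u0 i0.
have [c le_c [_]] := chain (r (size u0)).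
apply/negP; rewrite -ltnNge; apply: leq_ltn_trans rankU.
apply: rank_infix; apply/infix_windowP; exists d => //.
exact: leq_trans le_d (leq_trans le_c (leq_addr _ _)).
Qed.

(* [U] is longer than [V] but forced by it: this is why its length is allowed
   to exceed the iterated regulator, which only bounds [V]. *)
Lemma low_rank_word w r u0 k : SAP w -> ap_regulator w r -> occurs w u0 ->
  exists V U, [/\ occurs w V, size V = iter k r 1, size U <= size V + k,
    (forall j, occurs_at w V j -> occurs_at w U j) &
    #|img U| <= maxn #|img u0| (#|Q| - k)].
Proof.
move=> sap_w reg_w occ_u0; have r_ge l := regulator_ge l sap_w reg_w.
elim: k => [|k [V [U [occ_V szV szU VU rankU]]]].
  exists (window w 0 1), (window w 0 1); split=> //.
    by exists 0; exact: occurs_at_window.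
  by rewrite subn0 leq_max max_card orbT.
have V_gt0 : 0 < size V.
  by rewrite szV; elim: (k) => //= k' /leq_trans; apply; exact: r_ge.
have [i [d [occ_i d_gt0 occ_d min_d drop]]] :=
  rank_drop sap_w reg_w occ_u0 occ_V V_gt0 VU.
(* The search starts at [j.+1], so the next [V] may end one letter past the window of length
   [r (size V)] at [j]: this adds one forced letter per round. *)
have next j : exists2 d', 0 < d' /\ d' + size V <= (r (size V)).+1 &
    occurs_at w V (j + d').
  have /infix_windowP[d1 le_d1 occ_d1] := SAP_regulator sap_w reg_w occ_V j.+1.
  by exists d1.+1; rewrite -?addSnnS.
have [di [di_gt0 le_di] /(min_d _ di_gt0) le_d] := next i.
exists (window w i (r (size V))), (window w i (d + size U)); split.
- by exists i; exact: occurs_at_window.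
- by rewrite size_window szV.
- by rewrite !size_window; lia.
- move=> j occ_j.
  have sub d' : d' + size V <= r (size V) ->
    occurs_at w V (i + d') <-> occurs_at w V (j + d') by exact: sub_occurs_at.
  have occ_jd : occurs_at w V (j + d).
    have [dj [dj_gt0 le_dj] occ_dj] := next j.
    (* The smaller of two distinct return distances keeps its [V] inside the common window, so it
       can be transported to the other occurrence. *)
    have [lt_dj|lt_dj|-> //] := ltngtP d dj; first by apply/sub => //; lia.
    have /sub le_sub : dj + size V <= r (size V) by lia.
    by have := min_d _ dj_gt0 (le_sub.2 occ_dj); lia.
  rewrite window_cat (VU _ occ_d); apply/occurs_at_cat; split.
    have le_dr : 0 + size (window w i d) <= r (size V).
      by rewrite size_window; lia.
    rewrite -[j]addn0; apply/(sub_occurs_at occ_j le_dr).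
    by rewrite addn0; exact: occurs_at_window.
  by rewrite size_window; exact: VU.
- apply: leq_trans drop _; rewrite geq_max leq_maxl andTb.
  by move: rankU; rewrite !leq_max => /orP[]; lia.
Qed.

End Automaton.

Theorem theorem4 (Sigma Delta Q : finType) (F : automaton Sigma Delta Q)
    (n : nat) (hn : #|Q| = n) (w : nat -> Sigma) (hw : SAP w)
    (r : nat -> nat) (hr : ap_regulator w r) :
  eventually_SAP (run F w) /\
  exists2 m, is_pr (run F w) m & m <= \sum_(1 <= k < n.+1) iter k r 1.
Proof.
suff [m sap_m le_m] : exists2 m, SAP (suffix_from (run F w) m)
    & m <= \sum_(1 <= k < n.+1) iter k r 1.
  split; first by exists m.
  have [m' sap_m' min_m'] := @ex_least (fun k => SAP (suffix_from (run F w) k))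
    m sap_m.
  by exists m'; [split | apply: leq_trans (min_m' _ sap_m) le_m].
have n_gt0 : 0 < n by rewrite -hn; apply/card_gt0P; exists (init F).
have iter_gt0 k : 0 < iter k r 1.
  by elim: k => //= k /leq_trans; apply; exact: regulator_ge hw hr.
have [_ [u0 occ_u0 ->] min_u0] :
    exists2 k, (exists2 u, occurs w u & k = #|img F u|)
      & forall k', (exists2 u, occurs w u & k' = #|img F u|) -> k <= k'.
  by apply: (@ex_least _ #|img F [::]|); exists [::] => //; exists 0.
have [V [U [occ_V szV szU VU rankU]]] := low_rank_word F n.-1 hw hr occ_u0.
have /infix_windowP[j le_j /VU] := SAP_regulator hw hr occ_V 0.
rewrite add0n => occ_U; exists (j + size U).
  apply: SAP_after_min_rank hw hr occ_U _ => y occ_y.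
  have le_y : #|img F u0| <= #|img F y| by apply: min_u0; exists y.
  by apply: leq_trans rankU _; rewrite geq_max le_y hn; have := rank_gt0 F y; lia.
rewrite big_nat_recr //.
have -> : iter n r 1 = r (size V) by rewrite szV -iterS prednK.
(* The at most [n.-1] forced letters of [U] are paid for by the first [n.-1] terms of the sum, each
   at least 1. *)
have le_sum : n.-1 <= \sum_(1 <= k < n) iter k r 1.
  rewrite -subn1 -[X in X <= _]muln1 -sum_nat_const_nat.
  by apply: leq_sum => k _.
by apply: leq_trans (leq_add le_sum le_j); lia.
Qed.
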